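(* Let $M=\{(x,y,z)\in\mathbb{R}^3 : (x-y)(y-z)(z-x)\neq 0\}$, let $v,u,w$ be the vector fields of the Darboux-Halphen system defined in the context, and let $(\beta,\alpha,\gamma)$ be the one-forms on $M$ dual to $(v,u,w)$. Then the one-form $\alpha$ is not integrable in the sense of Frobenius: $\alpha\wedge d\alpha\neq 0$ on $M$. Moreover, the condition $\alpha\wedge d\alpha\neq 0$ is equivalent to the non-vanishing of the (Godbillon-Vey) three-form, $\alpha\wedge\beta\wedge\gamma\neq 0$.
   Context: The Darboux-Halphen vector field on $\mathbb{R}^3$ with coordinates $(x,y,z)$ is $$v=(yz-xy-xz)\frac{\partial}{\partial x}+(xz-xy-yz)\frac{\partial}{\partial y}+(xy-xz-yz)\frac{\partial}{\partial z},$$ and $u=2\left(x\frac{\partial}{\partial x}+y\frac{\partial}{\partial y}+z\frac{\partial}{\partial z}\right)$, $w=\frac{\partial}{\partial x}+\frac{\partial}{\partial y}+\frac{\partial}{\partial z}$. These are linearly independent at each point where $x,y,z$ are pairwise distinct. The dual one-forms $(\beta,\alpha,\gamma)$ are determined by $\beta(v)=\alpha(u)=\gamma(w)=1$, with all other pairings ($\beta(u),\beta(w),\alpha(v),\alpha(w),\gamma(v),\gamma(u)$) equal to zero. Explicitly, writing $\mathbf{u},\mathbf{v},\mathbf{w}$ for the component vectors of $u,v,w$, $d\mathbf{x}=(dx,dy,dz)$ and $\rho^{-1}=-(\mathbf{u}\times\mathbf{v})\cdot\mathbf{w}=-4(x-y)(y-z)(z-x)$, one has $\beta=\rho\,(\mathbf{u}\times\mathbf{w})\cdot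 d\mathbf{x}$, $\alpha=\rho\,(\mathbf{w}\times\mathbf{v})\cdot d\mathbf{x}$, $\gamma=\rho\,(\mathbf{v}\times\mathbf{u})\cdot d\mathbf{x}$. A one-form $\omega$ is called integrable in the sense of Frobenius if $\omega\wedge d\omega=0$. The inequalities $\neq 0$ for three-forms mean non-vanishing at every point of $M$. *)

(* Defs.v *)
From HB Require Import structures.
From mathcomp Require Import all_boot all_order all_algebra.
From mathcomp Require Import ring.
From mathcomp Require Import all_classical all_reals all_analysis.

Set Implicit Arguments.
Unset Strict Implicit.
Unset Printing Implicit Defensive.

Import Order.TTheory GRing.Theory Num.Theory.
Import numFieldNormedType.Exports.
Local Open Scope classical_set_scope.
Local Open Scope ring_scope.

Section Forms.
Variable R : realType.

Definition row3 (a b c : R) : 'rV[R]_3 := \row_(j < 3) [:: a; b; c]`_j.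

Definition vector_field : Type := 'rV[R]_3 -> 'rV[R]_3.

(* A form on an open subset of R^3 is given by a total function of the base
   point whose values outside the subset are irrelevant: [ext_d] at a point
   only depends on the form near that point.  For two- and three-forms, being
   multilinear and alternating is not part of the type. *)
Definition one_form : Type := 'rV[R]_3 -> {scalar 'rV[R]_3}.
Definition two_form : Type := 'rV[R]_3 -> 'rV[R]_3 -> 'rV[R]_3 -> R.
Definition three_form : Type :=
  'rV[R]_3 -> 'rV[R]_3 -> 'rV[R]_3 -> 'rV[R]_3 -> R.

(* d omega (X, Y) = X (omega (Y)) - Y (omega (X)) for constant vector fields
   X and Y, whose bracket vanishes; 'D_X is the directional derivative. *)
Definition ext_d (omega : one_form) : two_form := fun p X Y =>
  'D_X (fun q => omega q Y) p - 'D_Y (fun q => omega q X) p.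

Definition wedge11 (omega eta : one_form) : two_form := fun p X Y =>
  omega p X * eta p Y - omega p Y * eta p X.

Definition wedge12 (omega : one_form) (eta : two_form) : three_form :=
  fun p X Y Z =>
    omega p X * eta p Y Z + omega p Y * eta p Z X + omega p Z * eta p X Y.

Definition frobenius_integrable (M : set 'rV[R]_3) (omega : one_form) : Prop :=
  forall p, M p -> forall X Y Z, wedge12 omega (ext_d omega) p X Y Z = 0.

Definition nonvanishing_on (M : set 'rV[R]_3) (eta : three_form) : Prop :=
  forall p, M p -> exists X Y Z, eta p X Y Z != 0.

Definition dual_coframe (M : set 'rV[R]_3) (e1 e2 e3 : vector_field)
    (f1 f2 f3 : one_form) : Prop :=
  forall p, M p ->
    [/\ [/\ f1 p (e1 p) = 1, f1 p (e2 p) = 0 & f1 p (e3 p) = 0],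
        [/\ f2 p (e1 p) = 0, f2 p (e2 p) = 1 & f2 p (e3 p) = 0] &
        [/\ f3 p (e1 p) = 0, f3 p (e2 p) = 0 & f3 p (e3 p) = 1]].

End Forms.

Section DarbouxHalphen.
Variable R : realType.

Definition dh_domain : set 'rV[R]_3 :=
  [set p | let x := p 0 0 in let y := p 0 1 in let z := p 0 2 in
           (x - y) * (y - z) * (z - x) != 0].

Definition dh_v : vector_field R := fun p =>
  let x := p 0 0 in let y := p 0 1 in let z := p 0 2 in
  row3 (y * z - x * y - x * z) (x * z - x * y - y * z) (x * y - x * z - y * z).

Definition dh_u : vector_field R := fun p => 2 *: p.

Definition dh_w : vector_field R := fun=> row3 1 1 1.

Definition crossv (a b : 'rV[R]_3) : 'rV[R]_3 :=
  row3 (a 0 1 * b 0 2 - a 0 2 * b 0 1) (a 0 2 * b 0 0 - a 0 0 * b 0 2)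
       (a 0 0 * b 0 1 - a 0 1 * b 0 0).

Definition dotv (a b : 'rV[R]_3) : R := \sum_(j < 3) a 0 j * b 0 j.

Lemma dotv_is_linear (a : 'rV[R]_3) : linear_for *%R (dotv a).
Proof. by move=> k X Y; rewrite /dotv !big_ord_recl !big_ord0 !mxE; ring. Qed.

HB.instance Definition _ (a : 'rV[R]_3) :=
  GRing.isLinear.Build R 'rV[R]_3 R *%R (dotv a) (dotv_is_linear a).

Definition dh_rho (p : 'rV[R]_3) : R :=
  (- dotv (crossv (dh_u p) (dh_v p)) (dh_w p))^-1.

Definition dh_beta : one_form R := fun p =>
  dotv (dh_rho p *: crossv (dh_u p) (dh_w p)).
Definition dh_alpha : one_form R := fun p =>
  dotv (dh_rho p *: crossv (dh_w p) (dh_v p)).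
Definition dh_gamma : one_form R := fun p =>
  dotv (dh_rho p *: crossv (dh_v p) (dh_u p)).

Lemma ord3E : (lift ord0 ord0 = 1 :> 'I_3) *
  (lift ord0 (lift ord0 ord0) = 2 :> 'I_3).
Proof. by split; apply/val_inj. Qed.

Lemma dh_rhoV (p : 'rV[R]_3) : (dh_rho p)^-1 =
  - 4 * ((p 0 0 - p 0 1) * (p 0 1 - p 0 2) * (p 0 2 - p 0 0)).
Proof.
rewrite /dh_rho invrK /dotv !big_ord_recl big_ord0 !ord3E.
rewrite /dh_u /dh_w /dh_v /crossv /row3 !mxE /= ?mxE /=.
by ring.
Qed.

(* The dual coframe exists, and is given by the classical cross-product
   formulas. *)
Lemma dh_dual_coframe :
  dual_coframe dh_domain dh_v dh_u dh_w dh_beta dh_alpha dh_gamma.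
Proof.
move=> p Mp.
have r0 : (dh_rho p)^-1 != 0.
  by rewrite dh_rhoV mulf_neq0// oppr_eq0 pnatr_eq0.
have rE := dh_rhoV p.
have r1 : dh_rho p * (dh_rho p)^-1 = 1.
  by rewrite divff// -invr_eq0.
rewrite rE in r1.
rewrite /dh_beta /dh_alpha /dh_gamma /=.
split; split; rewrite /dotv !big_ord_recl big_ord0 !ord3E;
  rewrite /dh_u /dh_w /dh_v /crossv /row3 !mxE /= ?mxE /=.
all: try (by ring).
all: by rewrite -[RHS]r1; ring.
Qed.

End DarbouxHalphen.

(* Main.v *)
Require Import Defs.
From HB Require Import structures.
From mathcomp Require Import all_boot all_order all_algebra.
From mathcomp Require Import ring.
From mathcomp Require Import all_classical all_reals all_analysis.

Set Implicit Arguments.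
Unset Strict Implicit.
Unset Printing Implicit Defensive.

Import Order.TTheory GRing.Theory Num.Theory.
Import numFieldNormedType.Exports.
Local Open Scope classical_set_scope.
Local Open Scope ring_scope.

(** The fields v, u, w span the Lie algebra sl2: [v, w] = u, [u, v] = 2 v and
    [u, w] = - 2 w.  For the dual coframe, whose mutual pairings are constant,
    d alpha (X, Y) = - alpha ([X, Y]) whenever X and Y are among v, u, w, so
    that d alpha takes the value -1 on (v, w) and vanishes on (u, v) and
    (u, w).  This is the Maurer-Cartan equation d alpha = - beta /\ gamma, and
    it implies alpha /\ d alpha = - alpha /\ beta /\ gamma.  A coframe has a
    nonvanishing volume form, here equal to 1 on (u, v, w); hence both
    three-forms vanish nowhere, and alpha is not integrable because the domain
    is nonempty.

    The Maurer-Cartan equation is [dh_alpha_structure].  It is checked in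
    coordinates rather than through brackets: since duality determines the
    coframe ([dual_coframe_unique]), alpha agrees on the domain with an
    explicit rational form ([dh_alphaE]), and since the domain is open
    ([near_dh_domain]), its derivatives there are those of that form. *)

(** * The coframe is determined by duality *)

Lemma dotvE (R : realType) (a b : 'rV[R]_3) :
  dotv a b = a 0 0 * b 0 0 + a 0 1 * b 0 1 + a 0 2 * b 0 2.
Proof. by rewrite /dotv !big_ord_recl big_ord0 !ord3E addr0 addrA. Qed.

Definition vandermonde3 (R : realType) (p : 'rV[R]_3) : R :=
  (p 0 0 - p 0 1) * (p 0 1 - p 0 2) * (p 0 2 - p 0 0).

Lemma dh_rhoE (R : realType) (p : 'rV[R]_3) :
  dh_rho p = (- 4 * vandermonde3 p)^-1.
Proof. by rewrite -[LHS]invrK dh_rhoV. Qed.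

Lemma dh_rho_den_neq0 (R : realType) (p : 'rV[R]_3) :
  dh_domain p -> - 4 * vandermonde3 p != 0.
Proof. by move=> Mp; rewrite mulf_neq0// oppr_eq0 pnatr_eq0. Qed.

(** The fields v, u, w span the tangent space at every point of the domain:
    this is Cramer's rule, with [dh_rho] the inverse of the determinant. *)
Lemma dh_frame_expansion (R : realType) (p X : 'rV[R]_3) : dh_domain p ->
  X = dh_beta p X *: dh_v p + dh_alpha p X *: dh_u p
      + dh_gamma p X *: dh_w p.
Proof.
move=> Mp; have r1 : dh_rho p * (- 4 * vandermonde3 p) = 1.
  by rewrite dh_rhoE mulVf// dh_rho_den_neq0.
rewrite /dh_beta /dh_alpha /dh_gamma/=.
apply/rowP; case; case=> [|[|[|//]]] i3.
all: [> set i := Ordinal i3; have -> : i = 0 by exact/val_inj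
      | set i := Ordinal i3; have -> : i = 1 by exact/val_inj
      | set i := Ordinal i3; have -> : i = 2 by exact/val_inj ].
(* Multiplying the left-hand side by rho times its inverse turns each
   coordinate into a polynomial identity in rho, p and X. *)
all: rewrite -[LHS]mul1r -r1 /vandermonde3 !dotvE
       /dh_u /dh_w /dh_v /crossv /row3 !mxE /= ?mxE /=; ring.
Qed.

Lemma dual_coframe_unique (R : realType) (beta alpha gamma : one_form R) :
  dual_coframe (@dh_domain R) (@dh_v R) (@dh_u R) (@dh_w R)
    beta alpha gamma ->
  forall p X, dh_domain p ->
  [/\ beta p X = dh_beta p X, alpha p X = dh_alpha p X &
      gamma p X = dh_gamma p X].
Proof.
move=> hdual p X Mp; have [[bv bu bw] [av au aw] [gv gu gw]] := hdual p Mp.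
have expand (f : {scalar 'rV[R]_3}) : f X =
    dh_beta p X * f (dh_v p) + dh_alpha p X * f (dh_u p)
    + dh_gamma p X * f (dh_w p).
  by rewrite {1}(dh_frame_expansion X Mp) !linearD; congr (_ + _ + _);
    rewrite linearZ.
split; rewrite expand ?(bv, bu, bw, av, au, aw, gv, gu, gw).
all: by rewrite !mulr0 mulr1 ?addr0 ?add0r.
Qed.

(** The pairing of Y with the cross product of w and v. *)
Definition dh_alpha_num (R : realType) (Y p : 'rV[R]_3) : R :=
  2 * (p 0 0 * (p 0 1 - p 0 2) * Y 0 0 + p 0 1 * (p 0 2 - p 0 0) * Y 0 1
       + p 0 2 * (p 0 0 - p 0 1) * Y 0 2).

Lemma dh_alphaE (R : realType) (p Y : 'rV[R]_3) :
  dh_alpha p Y = dh_alpha_num Y p * (- 4 * vandermonde3 p)^-1.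
Proof.
rewrite /dh_alpha/= dotvE dh_rhoE /dh_alpha_num /dh_w /dh_v /crossv /row3.
by rewrite !mxE /= ?mxE /=; ring.
Qed.

(** * Directional derivatives *)

Lemma is_derive_coord (R : realType) (p X : 'rV[R]_3) (i : 'I_3) :
  is_derive p X (fun q : 'rV[R]_3 => q 0 i) (X 0 i).
Proof.
apply: DeriveDef; first exact/diff_derivable/differentiable_coord.
(* The difference quotients of a linear function are constant. *)
apply/cvg_lim => //; apply: cvg_near_cst.
near=> h; rewrite /= !mxE addrK; apply: mulKf.
by near: h; exact: nbhs_dnbhs_neq.
Unshelve. all: by end_near. Qed.

#[local] Existing Instance is_derive_coord.

Lemma is_derive_alpha_num (R : realType) (p X Y : 'rV[R]_3) :
  is_derive p X (dh_alpha_num Y)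
    (2 * ((X 0 0 * (p 0 1 - p 0 2) + p 0 0 * (X 0 1 - X 0 2)) * Y 0 0
        + (X 0 1 * (p 0 2 - p 0 0) + p 0 1 * (X 0 2 - X 0 0)) * Y 0 1
        + (X 0 2 * (p 0 0 - p 0 1) + p 0 2 * (X 0 0 - X 0 1)) * Y 0 2)).
Proof.
by rewrite /dh_alpha_num; apply: is_derive_eq; rewrite /GRing.scale/=; ring.
Qed.

Lemma is_derive_rho_den (R : realType) (p X : 'rV[R]_3) :
  is_derive p X (fun q => - 4 * vandermonde3 q)
    (- 4 * ((X 0 0 - X 0 1) * (p 0 1 - p 0 2) * (p 0 2 - p 0 0)
          + (p 0 0 - p 0 1) * (X 0 1 - X 0 2) * (p 0 2 - p 0 0)
          + (p 0 0 - p 0 1) * (p 0 1 - p 0 2) * (X 0 2 - X 0 0))).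
Proof.
by rewrite /vandermonde3; apply: is_derive_eq; rewrite /GRing.scale/=; ring.
Qed.

#[local] Existing Instance is_derive_alpha_num.
#[local] Existing Instance is_derive_rho_den.

Lemma near_dh_domain (R : realType) (p : 'rV[R]_3) :
  dh_domain p -> \forall q \near p, dh_domain q.
Proof.
move=> Mp.
have cont : {for p, continuous (@vandermonde3 R)}.
  apply: differentiable_continuous.
  by do 2?apply: differentiableM; apply: differentiableB;
    exact: differentiable_coord.
exact: cvgr_neq0 cont Mp.
Qed.

(** * The Maurer-Cartan equation and its consequences *)

(** The coefficient -1 of beta /\ gamma is - alpha ([v, w]); no term in
    alpha /\ beta or alpha /\ gamma occurs since [u, v] and [u, w] have no
    component along u. *)
Lemma dh_alpha_structure (R : realType) (beta alpha gamma : one_form R) :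
  dual_coframe (@dh_domain R) (@dh_v R) (@dh_u R) (@dh_w R)
    beta alpha gamma ->
  forall p X Y, dh_domain p ->
  ext_d alpha p X Y = - wedge11 beta gamma p X Y.
Proof.
move=> hdual p X Y Mp; have D0 := dh_rho_den_neq0 Mp.
have dV Z : derivable (fun q : 'rV[R]_3 => (- 4 * vandermonde3 q)^-1) p Z.
  exact: derivableV.
have derE Z W : 'D_Z (fun q => alpha q W) p =
    'D_Z (fun q => dh_alpha_num W q * (- 4 * vandermonde3 q)^-1) p.
  apply: near_eq_derive; near=> q; rewrite -dh_alphaE.
  have Mq : dh_domain q by near: q; exact: near_dh_domain.
  by have [_ -> _] := dual_coframe_unique hdual W Mq.
rewrite /ext_d /wedge11 !derE [X in X - _]deriveM// [X in _ - X]deriveM//.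
rewrite !deriveV// !derive_val.
have [-> _ ->] := dual_coframe_unique hdual X Mp.
have [-> _ ->] := dual_coframe_unique hdual Y Mp.
rewrite /dh_beta /dh_gamma/= !dotvE dh_rhoE.
rewrite /dh_u /dh_w /dh_v /crossv /row3 !mxE /= ?mxE /=.
rewrite /GRing.scale/= /dh_alpha_num /vandermonde3.
move: Mp; rewrite /dh_domain/= !mulf_eq0 !negb_or => /andP[/andP[xy yz] zx].
by field; rewrite xy yz zx.
Unshelve. all: by end_near. Qed.

Lemma wedge_alpha_d_alpha (R : realType) (beta alpha gamma : one_form R) :
  dual_coframe (@dh_domain R) (@dh_v R) (@dh_u R) (@dh_w R)
    beta alpha gamma ->
  forall p X Y Z, dh_domain p ->
  wedge12 alpha (ext_d alpha) p X Y Z =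
  - wedge12 alpha (wedge11 beta gamma) p X Y Z.
Proof.
move=> hdual p X Y Z Mp.
by rewrite /wedge12 !(dh_alpha_structure hdual)// !mulrN !opprD.
Qed.

Lemma dual_coframe_volume (R : realType) (M : set 'rV[R]_3)
    (e1 e2 e3 : vector_field R) (f1 f2 f3 : one_form R) :
  dual_coframe M e1 e2 e3 f1 f2 f3 -> forall p, M p ->
  wedge12 f2 (wedge11 f1 f3) p (e2 p) (e1 p) (e3 p) = 1.
Proof.
move=> hdual p /hdual[[f11 f12 f13] [f21 f22 f23] [f31 f32 f33]].
by rewrite /wedge12 /wedge11 f11 f13 f21 f22 f23 f31 f33; ring.
Qed.

Lemma dh_domain_nonempty (R : realType) : dh_domain (row3 0 1 2 : 'rV[R]_3).
Proof.
rewrite /dh_domain/= /row3 !mxE/=.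
have -> : (0 - 1) * (1 - 2) * (2 - 0) = 2 :> R by ring.
by rewrite pnatr_eq0.
Qed.

Theorem mainTheorem1 (R : realType) (beta alpha gamma : one_form R)
    (hdual : dual_coframe (@dh_domain R) (@dh_v R) (@dh_u R) (@dh_w R)
               beta alpha gamma) :
  [/\ ~ frobenius_integrable (@dh_domain R) alpha,
      nonvanishing_on (@dh_domain R) (wedge12 alpha (ext_d alpha)) &
      nonvanishing_on (@dh_domain R) (wedge12 alpha (ext_d alpha)) <->
      nonvanishing_on (@dh_domain R) (wedge12 alpha (wedge11 beta gamma))].
Proof.
have equiv : nonvanishing_on (@dh_domain R) (wedge12 alpha (ext_d alpha)) <->
    nonvanishing_on (@dh_domain R) (wedge12 alpha (wedge11 beta gamma)).
  split=> nv p Mp; have [X [Y [Z nz]]] := nv p Mp; exists X, Y, Z; move: nz;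
    by rewrite (wedge_alpha_d_alpha hdual) ?oppr_eq0.
have nonvanishing :
    nonvanishing_on (@dh_domain R) (wedge12 alpha (ext_d alpha)).
  apply/equiv => p Mp; exists (dh_u p), (dh_v p), (dh_w p).
  by rewrite (dual_coframe_volume hdual) ?oner_eq0.
split=> // integrable.
have [X [Y [Z /eqP]]] := nonvanishing _ (dh_domain_nonempty R).
by apply; exact: integrable (dh_domain_nonempty R) X Y Z.
Qed.
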